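(* Let $\{X_t\,|\,t\ge 0\}$ be a stationary, stochastically monotone, time-homogeneous real-valued Markov process satisfying the increment condition (defined in the context), in either discrete time (all time parameters being nonnegative integers) or continuous time (all time parameters being nonnegative reals). Then for every $s>0$ and every Borel supermodular $h:\mathbb{R}^2\to\mathbb{R}$ for which the following expectations exist and are finite, $\mathbb{E}\,h(X_0,X_t-X_{t+s})$ is nonincreasing in $t\ge 0$. In particular, when $f:\mathbb{R}\to\mathbb{R}$ is nondecreasing and the appropriate expectations (those of $f(X_0)$, $X_0$ and $f(X_0)X_t$, $t\ge 0$) exist and are finite, $\mathrm{Cov}(f(X_0),X_t)$ is nonnegative, nonincreasing and convex in $t$.
   Context: A Markov transition kernel $p(x,A)$ ($x\in\mathbb{R}$, $A\subset\mathbb{R}$ Borel) is such that $p(\cdot,A)$ is a Borel function for every Borel $A$ and $p(x,\cdot)$ is a probability measure for every $x$. It is stochastically monotone if $p(x,(y,\infty))$ is nondecreasing in $x$ for each $y\in\mathbb{R}$. It satisfies the increment condition if $p(x,(x+y,\infty))$ is nonincreasing in $x$ for each $y\in\mathbb{R}$. A discrete-time time-homogeneous Markov process is stochastically monotone (resp. satisfies the increment condition) if its one-step transition kernel does. A continuous-time time-homogeneous Markov process is stochastically monotone (resp. satisfies the increment condition) if the kernel $p^t(x,A)=\mathbb{P}_x(X_t\in A)$ does for each $t>0$. A function $h:\mathbb{R}^2\to\mathbb{R}$ is supermodular if $h(x_1,y_2)+h(x_2,y_1)\le h(x_1,y_1)+h(x_2,y_2)$ whenever $x_1\le x_2$ and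 $y_1\le y_2$. In discrete time, a sequence $(a_t)_{t\ge 0}$ is convex if $a_{t+1}-a_t$ is nondecreasing in $t$. *)

(* Defs.v *)
From HB Require Export structures.
From mathcomp Require Export all_boot all_order all_algebra.
From mathcomp Require Export all_classical all_reals all_analysis.

Set Implicit Arguments.
Unset Strict Implicit.
Unset Printing Implicit Defensive.

Export Order.TTheory GRing.Theory Num.Theory.
Export numFieldNormedType.Exports.

Open Scope classical_set_scope.
Open Scope ring_scope.

Definition stoch_monotone (R : realType) (p : R.-pker R ~> R) :=
  forall y x1 x2 : R, x1 <= x2 ->
    (p x1 `]y, +oo[%classic <= p x2 `]y, +oo[%classic)%E.

Definition increment_condition (R : realType) (p : R.-pker R ~> R) :=
  forall y x1 x2 : R, x1 <= x2 ->
    (p x2 `](x2 + y)%R, +oo[%classic <= p x1 `](x1 + y)%R, +oo[%classic)%E.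

Definition supermodular (R : realType) (h : R * R -> R) :=
  forall x1 x2 y1 y2 : R, x1 <= x2 -> y1 <= y2 ->
    h (x1, y2) + h (x2, y1) <= h (x1, y1) + h (x2, y2).

(* The sigma-algebra on the sample space generated by the X u, u in U. *)
Definition history d (Omega : measurableType d) (R : realType) (I : Type)
    (X : I -> Omega -> R) (U : set I) : set (set Omega) :=
  <<s \bigcup_(u in U) g_sigma_algebra_preimage (X u) >>.

(* Shift invariance of the finite-dimensional distributions, D being the set
   of admissible times.  These distributions are compared on measurable
   rectangles, which determine them. *)
Definition stationary d (Omega : measurableType d) (R : realType)
    (P : probability Omega R) (I : nmodType) (D : set I)
    (X : I -> {RV P >-> R}) :=
  forall (n : nat) (t : 'I_n -> I) (s : I) (A : 'I_n -> set R),
    (forall i, D (t i)) -> D s -> (forall i, measurable (A i)) ->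
    P [set w | forall i, A i (X (t i + s) w)] =
    P [set w | forall i, A i (X (t i) w)].

(* P (X_{n+1} \in A | X_0, ..., X_n) = p (X_n, A) almost surely, written with
   the defining property of conditional probabilities. *)
Definition discrete_markov d (Omega : measurableType d) (R : realType)
    (P : probability Omega R) (X : nat -> {RV P >-> R})
    (p : R.-pker R ~> R) :=
  forall (n : nat) (F : set Omega) (A : set R),
    history X [set u | (u <= n)%N] F -> measurable A ->
    P (F `&` X n.+1 @^-1` A) = (\int[P]_(w in F) p (X n w) A)%E.

(* p t x A stands for P_x (X_t \in A).  Only the times t >= 0 matter. *)
Definition transition_semigroup (R : realType) (p : R -> R.-pker R ~> R) :=
  (forall (x : R) (A : set R), measurable A -> p 0 x A = \d_x A) /\
  (forall (s t x : R) (A : set R), 0 <= s -> 0 <= t -> measurable A ->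
     p (s + t) x A = (\int[p s x]_y p t y A)%E).

(* P (X_{t+s} \in A | X_u, 0 <= u <= t) = p s (X_t, A) almost surely. *)
Definition continuous_markov d (Omega : measurableType d) (R : realType)
    (P : probability Omega R) (X : R -> {RV P >-> R})
    (p : R -> R.-pker R ~> R) :=
  transition_semigroup p /\
  forall (t s : R) (F : set Omega) (A : set R), 0 <= t -> 0 <= s ->
    history X `[0, t]%classic F -> measurable A ->
    P (F `&` X (t + s) @^-1` A) = (\int[P]_(w in F) p s (X t w) A)%E.

Definition convex_seq (R : realType) (a : nat -> R) :=
  forall m n : nat, (m <= n)%N -> a m.+1 - a m <= a n.+1 - a n.

Definition hincr d (Omega : measurableType d) (R : realType)
    (P : probability Omega R) (I : nmodType) (X : I -> {RV P >-> R})
    (h : R * R -> R) (s t : I) : Omega -> R :=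
  fun w => h (X 0 w, X t w - X (t + s) w).

(* Cov (f (X_0), X_t) as a real number; [fine] is harmless when the
   covariance is finite. *)
Definition covf d (Omega : measurableType d) (R : realType)
    (P : probability Omega R) (I : nmodType) (X : I -> {RV P >-> R})
    (f : R -> R) (t : I) : R :=
  fine (covariance P (f \o X 0) (X t)).

(* Main.v *)
Require Import Defs.
From mathcomp Require Import measurable_realfun lra ring zify.

(** Put delta = t2 - t1.  By stationarity, E h(X_0, X_t1 - X_(t1+s)) equals
    E h(X_delta, Z) with Z = X_t2 - X_(t2+s), so everything reduces to
    E h(X_0, Z) <= E h(X_delta, Z) for this one variable Z.

    A transition kernel p is realised by its quantile transform: a uniform noise
    u moves x to the quantile G(x, u) of p(x, .).  Stochastic monotonicity says
    that x |-> G(x, u) is nondecreasing for each u, and the increment condition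
    says that x |-> x - G(x, u) is nondecreasing for each u
    ([quantile_map_order_preserving], [quantile_map_increment_reversing]).
    Composing such maps, Z = H(X_delta, xi) in law, jointly with the past of
    X_delta, where the noise xi is independent of that past and H is
    nondecreasing in its first argument ([driven_drop_map]).  With xi frozen,
    k(x, y) = h(x, H(y, xi)) is again supermodular, and X_0 and X_delta have the
    same law; so E k(X_0, X_delta) <= E k(X_delta, X_delta), the optimality of
    the diagonal coupling ([diagonal_optimal]).  Fubini's theorem then restores
    the noise ([supermodular_driven_le]).

    The optimality of the diagonal coupling is usually proved for right
    continuous k with separately integrable marginal terms.  Here k is only
    Borel and only the difference k(X_0, X_delta) - k(X_delta, X_delta) is
    integrable, so it is derived by duality.  The diagonal is cyclically monotone
    for k ([closed_chain_le0]), hence Rockafellar's construction provides a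
    finite Borel function phi with k(x, y) - k(y, y) <= phi(x) - phi(y)
    ([potential_ge]), and a variable dominated by phi(X_0) - phi(X_delta) has
    nonpositive mean, whether or not phi(X_0) is integrable
    ([integral_le_coboundary]).

    For the covariance C(t) of f(X_0) and X_t, the function h(x, y) = f(x) y is
    supermodular, and the first part says that C(t) - C(t+s) is nonincreasing in
    t.  The same argument with Z = X_t2 shows that C is nonincreasing
    ([supermodular_descent]), and with X_0 replaced by an independent copy it
    shows that C is nonnegative ([driven_association]).  In continuous time,
    convexity follows from the monotonicity of C and of its increments by
    interpolation on fine grids ([nonincreasing_chord_le]). *)

Set Implicit Arguments.
Unset Strict Implicit.
Unset Printing Implicit Defensive.

(** * Cyclical monotonicity and the potential of a supermodular function *)

Section cyclical_monotonicity.
Context {R : realType}.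
Implicit Types (h : R * R -> R) (x y z : R) (s : seq R).

Fixpoint chain_gain h x s : R :=
  if s is y :: s' then h (y, x) - h (x, x) + chain_gain h y s' else 0.

Lemma chain_gain_cat h x s1 s2 :
  chain_gain h x (s1 ++ s2) = chain_gain h x s1 + chain_gain h (last x s1) s2.
Proof.
elim: s1 x => [|y s1 ih] x /=; first by rewrite add0r.
by rewrite ih addrA.
Qed.

Lemma chain_gain_rot h x y s1 s2 :
  chain_gain h x (rcons (s1 ++ y :: s2) x) =
  chain_gain h y (rcons (s2 ++ x :: s1) y).
Proof.
rewrite -!cats1 -!catA/= !chain_gain_cat/= !chain_gain_cat/= !addr0.
lra.
Qed.

(** If a closed chain starts at its largest point x, with neighbours p before
    and q after it, supermodularity gives h(x, p) + h(q, x) <= h(x, x) + h(q, p):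
    cutting x out does not decrease the gain. *)
Lemma closed_chain_le0_top h x s : supermodular h ->
  (forall s', (size s' < size s)%N ->
    forall y, chain_gain h y (rcons s' y) <= 0) ->
  (forall y, y \in s -> y <= x) -> chain_gain h x (rcons s x) <= 0.
Proof.
move=> hs ih; case: s ih => [|q s] ih sx; first by rewrite /= subrr addr0.
have := ih s (leqnn _) q.
have px : last q s <= x by apply: sx; exact: mem_last.
have qx : q <= x by apply: sx; exact: mem_head.
have := hs _ _ _ _ qx px.
rewrite -!cats1 /= !chain_gain_cat/= !addr0.
lra.
Qed.

Lemma seq_max x s : exists2 m, m \in x :: s & forall y, y \in x :: s -> y <= m.
Proof.
elim: s x => [|y s ih] x.
  by exists x; rewrite ?mem_head// => y; rewrite inE => /eqP ->.
have [m ms mge] := ih y.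
have [xm|mx] := leP x m.
- exists m; first by rewrite in_cons ms orbT.
  by move=> z; rewrite inE => /predU1P[->//|]; exact: mge.
- exists x; first exact: mem_head.
  move=> z; rewrite inE => /predU1P[->//|/mge zm].
  exact: le_trans zm (ltW mx).
Qed.

(** Cyclical monotonicity of the diagonal: rotate the chain so that it starts at
    its largest point, cut that point out, and repeat. *)
Lemma closed_chain_le0 h x s : supermodular h ->
  chain_gain h x (rcons s x) <= 0.
Proof.
move=> hs; have [n] := ubnP (size s); elim: n s x => // n ih s x sn.
have ih' s' : (size s' < size s)%N ->
    forall y, chain_gain h y (rcons s' y) <= 0.
  by move=> s's y; apply: ih; apply: leq_trans s's _.
have [m ms mge] := seq_max x s.
move: ms; rewrite inE => /predU1P[mx|ms].
  subst m; apply: closed_chain_le0_top => // y ys.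
  by apply: mge; rewrite inE ys orbT.
case/splitPr: ms ih' mge {sn} => s1 s2 ih' mge.
rewrite chain_gain_rot; apply: closed_chain_le0_top => //.
  by move=> s' s's; apply: ih'; rewrite !size_cat/= in s's *; lia.
move=> y ys; apply: mge; move: ys; rewrite !(inE, mem_cat).
by case/or3P => ->; rewrite ?orbT.
Qed.

(** Rockafellar's potential, with the base point 0. *)
Definition potential h x : R :=
  sup [set chain_gain h 0 (rcons s x) | s in [set: seq R]].

(** Closing a chain from 0 to x bounds its gain by h(x, x) - h(0, x). *)
Lemma has_sup_chains h x : supermodular h ->
  has_sup [set chain_gain h 0 (rcons s x) | s in [set: seq R]].
Proof.
move=> hs; split; first by exists (chain_gain h 0 (rcons [::] x)), [::].
exists (h (x, x) - h (0, x)) => _ [s _ <-].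
have := closed_chain_le0 0 (rcons s x) hs.
by rewrite -[rcons (rcons _ _) _]cats1 chain_gain_cat last_rcons/=; lra.
Qed.

(** A chain ending at x can be prolonged to y, and gains h(y, x) - h(x, x). *)
Lemma potential_ge h x y : supermodular h ->
  h (y, x) - h (x, x) <= potential h y - potential h x.
Proof.
move=> hs; rewrite lerBrDl -lerBrDr; apply: sup_le_ub.
  by have [] := has_sup_chains x hs.
move=> _ [s _ <-]; rewrite lerBrDr.
apply: (@ub_le_sup _ [set chain_gain h 0 (rcons s y) | s in [set: seq R]]).
  by have [] := has_sup_chains y hs.
exists (rcons s x) => //.
by rewrite -[rcons (rcons _ _) _]cats1 chain_gain_cat last_rcons/= addr0.
Qed.

(** By supermodularity, the increments of the potential on [z, +oo[ dominate
    those of h(., z); this is what makes the potential measurable. *)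
Lemma potential_sub_nd h z : supermodular h ->
  {in `[z, +oo[ &, {homo (fun x => potential h x - h (x, z)) : x y / x <= y}}.
Proof.
move=> hs x y; rewrite !in_itv/= !andbT => zx zy xy.
have := potential_ge x y hs.
have := hs _ _ _ _ xy zx; lra.
Qed.

End cyclical_monotonicity.

(** Freezing the potential to the left of - n leaves the sum of a monotone
    function and a section of h; let n tend to infinity. *)
Lemma measurable_potential {R : realType} (h : R * R -> R) :
  measurable_fun setT h -> supermodular h -> measurable_fun setT (potential h).
Proof.
move=> mh hs.
pose c n (x : R) := Num.max x (- n%:R).
have mc n : measurable_fun setT (c n).
  by apply: nondecreasing_measurable => // x y xy; apply: (le_max2 xy).
apply: (@measurable_fun_cvg _ _ _ _ (fun n x => potential h (c n x))) => //.
- move=> n; rewrite [X in measurable_fun _ X](_ : _ = fun x =>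
    (potential h (c n x) - h (c n x, - n%:R)) + h (c n x, - n%:R)); last first.
    by apply/funext => x; rewrite subrK.
  apply: measurable_funD.
    apply: nondecreasing_measurable => // x y xy.
    apply: (potential_sub_nd hs); last exact: (le_max2 xy).
    - by rewrite in_itv/= andbT le_max lexx orbT.
    - by rewrite in_itv/= andbT le_max lexx orbT.
  by apply: (measurableT_comp mh); apply: measurable_fun_pair.
- move=> x _; apply: cvg_near_cst; near=> n; congr potential.
  rewrite /c; apply/max_idPl; rewrite lerNl.
  by near: n; exact: nbhs_infty_ger.
Unshelve. all: by end_near. Qed.

(** * Equality in law *)

Definition same_law d1 d2 d (T1 : measurableType d1) (T2 : measurableType d2)
    (U : measurableType d) (R : realType) (m1 : {measure set T1 -> \bar R})
    (m2 : {measure set T2 -> \bar R}) (X1 : T1 -> U) (X2 : T2 -> U) :=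
  forall A, measurable A -> m1 (X1 @^-1` A) = m2 (X2 @^-1` A).

Section same_law.
Context d1 d2 d (T1 : measurableType d1) (T2 : measurableType d2)
  (U : measurableType d) (R : realType) (m1 : {measure set T1 -> \bar R})
  (m2 : {measure set T2 -> \bar R}) (X1 : T1 -> U) (X2 : T2 -> U).
Hypotheses (mX1 : measurable_fun setT X1) (mX2 : measurable_fun setT X2).
Hypothesis X12 : same_law m1 m2 X1 X2.
Local Open Scope ereal_scope.

Lemma ge0_same_law_integral f : measurable_fun setT f -> (forall x, 0 <= f x) ->
  \int[m1]_w f (X1 w) = \int[m2]_w f (X2 w).
Proof.
move=> mf f0.
rewrite -[LHS](ge0_integral_pushforward mX1 _ measurableT)//.
rewrite -[RHS](ge0_integral_pushforward mX2 _ measurableT)//.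
by apply: eq_measure_integral => A mA _; exact: X12.
Qed.

Lemma same_law_integrable f : measurable_fun setT f ->
  m1.-integrable setT (f \o X1) -> m2.-integrable setT (f \o X2).
Proof.
move=> mf /integrableP[_ f1]; apply/integrableP; split.
  exact: measurableT_comp.
rewrite -(@ge0_same_law_integral (abse \o f))//; first exact: measurableT_comp.
by move=> x; exact: abse_ge0.
Qed.

Lemma same_law_integral f : measurable_fun setT f ->
  m1.-integrable setT (f \o X1) ->
  \int[m1]_w f (X1 w) = \int[m2]_w f (X2 w).
Proof.
move=> mf f1; have f2 := same_law_integrable mf f1.
rewrite -[LHS](integral_pushforward mX1 mf f1 measurableT).
rewrite -[RHS](integral_pushforward mX2 mf f2 measurableT).
by apply: eq_measure_integral => A mA _; exact: X12.
Qed.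

End same_law.

(** * Optimality of the diagonal coupling *)

(** Clamping a and b to [- N, N] shrinks a - b without reversing its sign. *)
Lemma clamp_diff_le (R : realType) (N a b e : R) : 0 <= N -> e <= a - b ->
  `|Num.min e (Num.max (- N) (Num.min a N) - Num.max (- N) (Num.min b N))|
  <= `|e|.
Proof.
move=> N0 eab.
suff : (0 <= e -> 0 <= Num.max (- N) (Num.min a N) - Num.max (- N) (Num.min b N))
   /\ (e <= 0 -> e <= Num.max (- N) (Num.min a N) - Num.max (- N) (Num.min b N)).
  move: (_ - _) => t [e0t et]; rewrite ler_norml.
  case: (leP 0 e) => e0.
    have := e0t e0; rewrite (ger0_norm e0) => t0.
    apply/andP; split; first by rewrite le_min; apply/andP; split; lra.
    by rewrite ge_min lexx.
  by rewrite (min_idPl (et (ltW e0))) (ltr0_norm e0); apply/andP; split; lra.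
case: (leP a N) => aN; case: (leP b N) => bN.
all: case: (leP (- N) a) => ?; case: (leP (- N) b) => ?.
all: case: (leP (- N) N) => ?; split => *; lra.
Qed.

Section coboundary.
Context d (T : measurableType d) (R : realType) (P : probability T R)
  (X Y : T -> R).
Hypotheses (mX : measurable_fun setT X) (mY : measurable_fun setT Y).
Hypothesis XY : same_law P P X Y.
Local Open Scope ereal_scope.

(** Were phi(X) integrable, phi(X) - phi(Y) would have mean zero.  In general phi
    is clamped to [- n, n]: then min(D, phi_n(X) - phi_n(Y)) has nonpositive mean,
    it is dominated by |D| because clamping shrinks differences, and it equals D
    for n large. *)
Lemma integral_le_coboundary (phi : R -> R) (D : T -> R) :
  measurable_fun setT phi -> P.-integrable setT (EFin \o D) ->
  (forall w, D w <= phi (X w) - phi (Y w))%R ->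
  \int[P]_w (D w)%:E <= 0.
Proof.
move=> mphi iD Dphi.
pose c n (x : R) := Num.max (- n%:R)%R (Num.min (phi x) n%:R).
have mc n : measurable_fun setT (c n).
  by apply: measurable_maxr => //; exact: measurable_minr.
have cle n x : (`|c n x| <= n%:R)%R.
  rewrite /c ler_norml le_max lexx/= ge_max ge_min lexx orbT andbT.
  by rewrite (@le_trans _ _ 0%R)// oppr_le0.
pose D_ n w := Num.min (D w) (c n (X w) - c n (Y w))%R.
have mDd : measurable_fun setT D by exact/measurable_EFinP/(measurable_int _ iD).
have mdiff n : measurable_fun setT (fun w => c n (X w) - c n (Y w))%R.
  by apply: measurable_funB; exact: measurableT_comp.
have mD_ n : measurable_fun setT (EFin \o D_ n).
  by apply/measurable_EFinP; apply: measurable_minr.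
have DD n w : (`|D_ n w| <= `|D w|)%R.
  exact: clamp_diff_le.
have D_le n : \int[P]_w (D_ n w)%:E <= 0.
  have ic (Z : T -> R) : measurable_fun setT Z ->
      P.-integrable setT (EFin \o (fun w => c n (Z w))).
    move=> mZ; apply: (@le_integrable _ _ _ P _ measurableT _ (cst n%:R%:E)).
    - by apply/measurable_EFinP; exact: measurableT_comp.
    - move=> w _ /=; rewrite lee_fin (le_trans (cle n (Z w)))//.
      by rewrite ger0_norm.
    - exact: finite_measure_integrable_cst.
  apply: (@le_trans _ _ (\int[P]_w (c n (X w) - c n (Y w))%:E)).
    apply: le_integral => //.
    - apply: (@le_integrable _ _ _ P _ measurableT _ (EFin \o D)) => //.
        exact: mD_.
      by move=> w _ /=; rewrite lee_fin.
    - by under eq_fun do rewrite EFinB; apply: integrableB => //; exact: ic.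
    - by move=> w _; rewrite lee_fin ge_min lexx orbT.
  under eq_integral do rewrite EFinB.
  rewrite integralB//; [|exact: ic|exact: ic].
  rewrite (same_law_integral mX mY XY (f := EFin \o c n)) ?subee//.
  - by apply: integrable_fin_num => //; exact: ic.
  - exact/measurable_EFinP.
  - exact: ic.
have D_near w : \forall n \near \oo, D_ n w = D w.
  near=> n.
  have cphi x : (`|phi x| <= n%:R -> c n x = phi x)%R.
    by rewrite ler_norml /c => /andP[? ?]; rewrite (min_idPl _)// (max_idPr _).
  rewrite /D_ !cphi; last 2 first.
  - by near: n; exact: nbhs_infty_ger.
  - by near: n; exact: nbhs_infty_ger.
  by apply/min_idPl.
have aecvg : {ae P, forall w, [set: T] w ->
    (fun n => (EFin \o D_ n) w) @ \oo --> (EFin \o D) w}.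
  apply: aeW => w _; apply: cvg_near_cst.
  by apply: filterS (D_near w) => n /= ->.
have aeD : {ae P, forall w n, [set: T] w ->
    `|(EFin \o D_ n) w| <= (abse \o (EFin \o D)) w}.
  by apply: aeW => w n _ /=; rewrite lee_fin.
have [_ _ cvD] := dominated_convergence measurableT mD_ (measurable_int _ iD)
  aecvg (integrable_abse iD) aeD.
rewrite -(cvg_lim _ cvD)//; apply: lime_le; first exact: cvgP cvD.
by apply: nearW => n; exact: D_le.
Unshelve. all: by end_near. Qed.
End coboundary.

Section comonotone.
Context d (T : measurableType d) (R : realType) (P : probability T R)
  (X Y : T -> R).
Hypotheses (mX : measurable_fun setT X) (mY : measurable_fun setT Y).
Hypothesis XY : same_law P P X Y.
Local Open Scope ereal_scope.

Lemma diagonal_optimal (h : R * R -> R) :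
  measurable_fun setT h -> supermodular h ->
  P.-integrable setT
    (EFin \o (fun w => h (X w, Y w) - h (Y w, Y w))%R) ->
  \int[P]_w (h (X w, Y w) - h (Y w, Y w))%:E <= 0.
Proof.
move=> mh sh ih.
apply: (integral_le_coboundary mX mY XY (measurable_potential mh sh) ih) => w.
exact: potential_ge.
Qed.

End comonotone.

(** * Laws of pairs and random maps *)

Section product_law.
Local Open Scope ereal_scope.

Lemma measure_prod_unique d1 d2 (T1 : measurableType d1)
    (T2 : measurableType d2) (R : realType)
    (m1 m2 : {measure set (T1 * T2) -> \bar R}) :
  m1 setT < +oo ->
  (forall A B, measurable A -> measurable B -> m1 (A `*` B) = m2 (A `*` B)) ->
  forall E, measurable E -> m1 E = m2 E.
Proof.
move=> m1oo m12.
apply: (measure_unique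
  [set A `*` B | A in measurable & B in measurable] (fun=> setT)) => //.
- exact: measurable_prod_measurableType.
- move=> _ _ [A mA [B mB <-]] [C mC [D mD <-]]; rewrite -setXI.
  by exists (A `&` C); [exact: measurableI|exists (B `&` D) => //; exact: measurableI].
- by move=> _; exists setT => //; exists setT => //; rewrite setXTT.
- by rewrite bigcup_const//; exists 0%N.
- by move=> _ [A mA [B mB <-]]; exact: m12.
Qed.

Lemma same_law_pair d1 d2 d d' (T1 : measurableType d1)
    (T2 : measurableType d2) (U : measurableType d) (U' : measurableType d')
    (R : realType) (m1 : probability T1 R) (m2 : probability T2 R)
    (X1 : T1 -> U) (Y1 : T1 -> U') (X2 : T2 -> U) (Y2 : T2 -> U') :
  measurable_fun setT X1 -> measurable_fun setT Y1 ->
  measurable_fun setT X2 -> measurable_fun setT Y2 ->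
  (forall A B, measurable A -> measurable B ->
    m1 (X1 @^-1` A `&` Y1 @^-1` B) = m2 (X2 @^-1` A `&` Y2 @^-1` B)) ->
  same_law m1 m2 (fun w => (X1 w, Y1 w)) (fun w => (X2 w, Y2 w)).
Proof.
move=> mX1 mY1 mX2 mY2 XY E mE.
have mXY1 := measurable_fun_pair mX1 mY1.
have mXY2 := measurable_fun_pair mX2 mY2.
apply: (measure_prod_unique (m1 := pushforward m1 (fun w => (X1 w, Y1 w)))
  (m2 := pushforward m2 (fun w => (X2 w, Y2 w)))) => //.
  by rewrite /= /pushforward preimage_setT probability_setT ltry.
Qed.

Lemma same_law_comp d1 d2 d d' (T1 : measurableType d1)
    (T2 : measurableType d2) (U : measurableType d) (U' : measurableType d')
    (R : realType) (m1 : {measure set T1 -> \bar R})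
    (m2 : {measure set T2 -> \bar R})
    (X1 : T1 -> U) (X2 : T2 -> U) (f : U -> U') :
  measurable_fun setT f -> same_law m1 m2 X1 X2 ->
  same_law m1 m2 (f \o X1) (f \o X2).
Proof.
move=> mf X12 A mA; apply: (X12 (f @^-1` A)).
by rewrite -[X in measurable X]setTI; exact: mf.
Qed.

End product_law.

(** A kernel presented by a noise variable xi and a map: x is moved to
    g (x, xi).  The noise space is part of the data, so that maps can be composed
    on the product of their noise spaces. *)
Record random_map (R : realType) := RandomMap {
  noise_display : measure_display;
  noise : measurableType noise_display;
  noise_law : probability noise R;
  move_of :> R * noise -> R;
  measurable_move : measurable_fun [set: R * noise] move_of }.

Section random_map.
Context {R : realType}.
Implicit Types g : random_map R.

Definition order_preserving g :=
  forall xi x y, x <= y -> g (x, xi) <= g (y, xi).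

(** The displacement g (x, xi) - x is nonincreasing in x. *)
Definition increment_reversing g :=
  forall xi x y, x <= y -> x - g (x, xi) <= y - g (y, xi).

(** Z is obtained by applying g to Y with a noise independent of (V, Y), as
    far as the joint law of (V, Z) is concerned.  In applications Y is a function
    of the past of a process, and V any variable that depends on this past. *)
Definition driven d (T : measurableType d) (P : probability T R)
    dU (U : measurableType dU) (V : T -> U) (Y Z : T -> R) g :=
  same_law P (P \x noise_law g)%E (fun w => (V w, Z w))
    (fun w => (V w.1, g (Y w.1, w.2))).

End random_map.

Section drivenP.
Context d (T : measurableType d) (R : realType) (P : probability T R)
  dU (U : measurableType dU) (V : T -> U) (Y Z : T -> R) (g : random_map R).
Hypotheses (mV : measurable_fun setT V) (mY : measurable_fun setT Y)
  (mZ : measurable_fun setT Z).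
Local Open Scope ereal_scope.

Lemma measurable_driver :
  measurable_fun setT (fun w : T * noise g => g (Y w.1, w.2)).
Proof.
apply: measurableT_comp; first exact: measurable_move.
by apply: measurable_fun_pair => //; exact: measurableT_comp.
Qed.

(** The form taken by a Markov property: events generated by V suffice, because
    rectangles determine the law of (V, Z). *)
Lemma drivenI :
  (forall B A, measurable B -> measurable A ->
    P (V @^-1` B `&` Z @^-1` A) =
    \int[P]_(w in V @^-1` B) noise_law g [set xi | A (g (Y w, xi))]) ->
  driven P V Y Z g.
Proof.
move=> VZ; apply: same_law_pair => //.
- exact: measurableT_comp.
- exact: measurable_driver.
move=> B A mB mA; rewrite VZ// integral_mkcond /=.
apply: eq_integral => w _; rewrite patchE; case: ifPn => [/set_mem Bw|/negP Bw].
  congr (noise_law g _); apply/seteqP; split => xi /=; rewrite /xsection/= inE//.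
  by move=> [].
rewrite -[LHS](measure0 (noise_law g)); congr (noise_law g _).
by apply/seteqP; split => xi //=; rewrite /xsection/= inE => -[/= /mem_set].
Qed.

End drivenP.

Lemma ae_le0_integral_le0 d (T : measurableType d) (R : realType)
    (mu : {measure set T -> \bar R}) (f : T -> \bar R) :
  measurable_fun setT f -> {ae mu, forall x, (f x <= 0)%E} ->
  (\int[mu]_x f x <= 0)%E.
Proof.
move=> mf f0; rewrite integralE (@ae_eq_integral _ _ _ mu setT (cst 0%E)) //.
- by rewrite integral0 sub0e oppe_le0; exact: integral_ge0.
- exact: measurable_funepos.
- by apply: filterS f0 => x fx _; rewrite funeposE; apply/max_idPr.
Qed.

(** * The comparison with a random map *)

Section supermodular_driven.
Context d (T : measurableType d) (R : realType) (P : probability T R)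
  (X Y Z : T -> R) (g : random_map R).
Hypotheses (mX : measurable_fun setT X) (mY : measurable_fun setT Y)
  (mZ : measurable_fun setT Z).
Hypotheses (XY : same_law P P X Y) (gh : order_preserving g).
Hypotheses (XZ : driven P X Y Z g) (YZ : driven P Y Y Z g).
Local Open Scope ereal_scope.

(** Once the noise is frozen, Z is a nondecreasing function of Y, and the
    optimality of the diagonal coupling of (X, Y) applies. *)
Lemma supermodular_driven_le h :
  measurable_fun setT h -> supermodular h ->
  P.-integrable setT (fun w => (h (X w, Z w))%:E) ->
  P.-integrable setT (fun w => (h (Y w, Z w))%:E) ->
  \int[P]_w (h (X w, Z w))%:E <= \int[P]_w (h (Y w, Z w))%:E.
Proof.
move=> mh sh iX iY.
have mEh : measurable_fun setT (EFin \o h) by exact/measurable_EFinP.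
pose G (w : T * noise g) := g (Y w.1, w.2).
have mG : measurable_fun setT G by exact: measurable_driver.
have mpair (W : T -> R) : measurable_fun setT W ->
    measurable_fun setT (fun w : T * noise g => (W w.1, G w)).
  by move=> mW; apply: measurable_fun_pair => //; exact: measurableT_comp.
have jX := same_law_integrable (measurable_fun_pair mX mZ) (mpair _ mX) XZ mEh iX.
have jY := same_law_integrable (measurable_fun_pair mY mZ) (mpair _ mY) YZ mEh iY.
rewrite (same_law_integral (measurable_fun_pair mX mZ) (mpair _ mX) XZ mEh iX).
rewrite (same_law_integral (measurable_fun_pair mY mZ) (mpair _ mY) YZ mEh iY).
rewrite -sube_le0.
rewrite -integralB//.
have iD := integrableB measurableT jX jY.
rewrite -integral21_prod_meas1//.
apply: ae_le0_integral_le0; first exact: (measurable_fubini_G iD).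
apply: filterS (ae_integrable2 iD) => xi ixi.
apply: (diagonal_optimal mX mY XY (h := fun z => h (z.1, g (z.2, xi)))) => //.
- apply: measurableT_comp => //; apply: measurable_fun_pair => //.
  apply: measurableT_comp; first exact: measurable_move.
  exact: measurable_fun_pair.
- by move=> x1 x2 y1 y2 x12 y12; apply: sh => //; exact: gh.
Qed.

End supermodular_driven.

(** * Composition of random maps *)

Section composition.
Context {R : realType}.
Local Open Scope ereal_scope.

Lemma measurable_comp_move (g1 g2 : random_map R) :
  measurable_fun [set: R * (noise g1 * noise g2)]
    (fun z => g2 (g1 (z.1, z.2.1), z.2.2)).
Proof.
apply: measurableT_comp; first exact: measurable_move.
apply: measurable_fun_pair; last exact: measurableT_comp.
apply: measurableT_comp; first exact: measurable_move.
by apply: measurable_fun_pair => //; exact: measurableT_comp.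
Qed.

Definition comp_map (g1 g2 : random_map R) : random_map R :=
  @RandomMap R _ _ (noise_law g1 \x noise_law g2) _ (@measurable_comp_move g1 g2).

Lemma measurable_drop_move (g1 g2 : random_map R) :
  measurable_fun [set: R * (noise g1 * noise g2)]
    (fun z => g1 (z.1, z.2.1) - g2 (g1 (z.1, z.2.1), z.2.2))%R.
Proof.
apply: measurable_funB; last exact: measurable_comp_move.
apply: measurableT_comp; first exact: measurable_move.
by apply: measurable_fun_pair => //; exact: measurableT_comp.
Qed.

Definition drop_map (g1 g2 : random_map R) : random_map R :=
  @RandomMap R _ _ (noise_law g1 \x noise_law g2) _ (@measurable_drop_move g1 g2).

Lemma comp_map_order_preserving g1 g2 :
  order_preserving g1 -> order_preserving g2 ->
  order_preserving (comp_map g1 g2).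
Proof. by move=> h1 h2 xi x y xy; apply: h2; exact: h1. Qed.

(** x - g2 (g1 x) is the sum of x - g1 x and of (y - g2 y) at y = g1 x, which is
    nondecreasing in x. *)
Lemma comp_map_increment_reversing g1 g2 :
  order_preserving g1 ->
  increment_reversing g1 -> increment_reversing g2 ->
  increment_reversing (comp_map g1 g2).
Proof.
move=> h1 c1 c2 xi x y xy /=.
have := c1 xi.1 _ _ xy; have := c2 xi.2 _ _ (h1 xi.1 _ _ xy); lra.
Qed.

Lemma drop_map_order_preserving g1 g2 :
  order_preserving g1 -> increment_reversing g2 ->
  order_preserving (drop_map g1 g2).
Proof. by move=> h1 c2 xi x y xy; apply: c2; exact: h1. Qed.

Context d (T : measurableType d) (P : probability T R)
  dU (U : measurableType dU) (V : T -> U) (Y W Z : T -> R)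
  (g1 g2 : random_map R).
Hypotheses (mV : measurable_fun setT V) (mY : measurable_fun setT Y)
  (mW : measurable_fun setT W) (mZ : measurable_fun setT Z).
Hypotheses (YW : driven P V Y W g1)
  (WZ : driven P (fun w => (V w, W w)) W Z g2).

(** Two successive independent noises may be drawn together from the start: the
    law of (V, W, Z) is computed by conditioning on (V, W) first and on V next. *)
Lemma driven_trans :
  same_law P (P \x noise_law (comp_map g1 g2))
    (fun w => (V w, W w, Z w))
    (fun w => (V w.1, g1 (Y w.1, w.2.1), g2 (g1 (Y w.1, w.2.1), w.2.2))).
Proof.
have m1 : measurable_fun setT (fun w : T * noise g1 => (V w.1, g1 (Y w.1, w.2))).
  apply: measurable_fun_pair; first exact: measurableT_comp.
  exact: measurable_driver.
have m11 : measurable_fun setT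
    (fun w : T * (noise g1 * noise g2) => (V w.1, g1 (Y w.1, w.2.1))).
  apply: measurable_fun_pair; first exact: measurableT_comp.
  apply: measurableT_comp; first exact: measurable_move.
  by apply: measurable_fun_pair; exact: measurableT_comp.
apply: same_law_pair => //.
- exact: measurable_fun_pair.
- exact: (@measurable_driver _ _ _ _ (comp_map g1 g2) mY).
move=> E C mE mC.
pose S : set (U * R * noise g2) := [set z | E z.1 /\ C (g2 (z.1.2, z.2))].
have mS : measurable S.
  rewrite [S](_ : _ = fst @^-1` E `&` (fun z => g2 (z.1.2, z.2)) @^-1` C)//.
  apply: measurableI; rewrite -[X in measurable X]setTI.
    exact: measurable_fst.
  suff: measurable_fun setT (fun z : U * R * noise g2 => g2 (z.1.2, z.2)) by exact.
  apply: measurableT_comp; first exact: measurable_move.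
  by apply: measurable_fun_pair => //; exact: measurableT_comp.
pose q z := noise_law g2 (xsection S z).
have mq : measurable_fun setT q by exact: measurable_fun_xsection.
have -> : P ((fun w => (V w, W w)) @^-1` E `&` Z @^-1` C) =
    \int[P]_w q (V w, W w).
  rewrite [LHS](WZ (A := E `*` C)); last exact: measurableX.
  by apply: eq_integral => w _; congr (noise_law g2 _); apply/seteqP; split => xi;
    rewrite /xsection/= !inE.
rewrite (ge0_same_law_integral (measurable_fun_pair mV mW) m1 YW)//.
rewrite fubini_tonelli1//; last exact: measurableT_comp.
apply: eq_integral => w _; rewrite /fubini_F/=.
apply: eq_integral => xi1 _; congr (noise_law g2 _).
apply/seteqP; split => xi; first by move=> /set_mem ?; do 2!apply/mem_set.
by move=> /set_mem/set_mem ?; apply/mem_set.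
Qed.

Lemma driven_comp_map : driven P V Y Z (comp_map g1 g2).
Proof.
have mf : measurable_fun setT (fun z : U * R * R => (z.1.1, z.2)).
  by apply: measurable_fun_pair => //; exact: measurableT_comp.
exact: (same_law_comp mf driven_trans).
Qed.

Lemma driven_drop_map : driven P V Y (fun w => W w - Z w)%R (drop_map g1 g2).
Proof.
have mf : measurable_fun setT (fun z : U * R * R => (z.1.1, z.1.2 - z.2)%R).
  apply: measurable_fun_pair; first exact: measurableT_comp.
  by apply: measurable_funB => //; exact: measurableT_comp.
exact: (same_law_comp mf driven_trans).
Qed.

End composition.

(** * The quantile transform of a kernel *)

Section unit_noise.
Context {R : realType}.
Local Open Scope ereal_scope.

(* restricting to the open interval makes the values outside ]0, 1[ harmless *)
Let mu01 : {measure set (measurableTypeR R) -> \bar R} :=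
  mrestr lebesgue_measure (measurable_itv (Interval (BRight (0%R : R)) (BLeft 1%R))).

Let mu01_setT : mu01 setT = 1.
Proof.
rewrite /mu01/= /mrestr/= setTI lebesgue_measure_itv/= lte_fin ltr01.
by rewrite oppr0 adde0.
Qed.

Definition unit_noise : probability (measurableTypeR R) R :=
  HB.pack (mu01 : set (measurableTypeR R) -> \bar R)
  mu01 (Measure_isProbability.Build _ _ _ mu01 mu01_setT).

Lemma unit_noiseE (A : set R) (c : R) : (0 <= c <= 1)%R ->
  (forall u, 0 < u < 1 -> A u <-> u < c)%R -> unit_noise A = c%:E.
Proof.
move=> /andP[c0 c1] Ac.
have -> : unit_noise A = lebesgue_measure (`]0%R, c[%classic : set R).
  rewrite /unit_noise/= /mu01 /mrestr; congr lebesgue_measure.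
  apply/seteqP; split => u /=; rewrite !in_itv/=.
    by move=> [Au u01]; have [->] := andP u01; rewrite (Ac u u01).1.
  move=> /andP[u0 uc]; have u01 : (0 < u < 1)%R by rewrite u0 (lt_le_trans uc).
  by split => //; apply/(Ac u u01).
rewrite lebesgue_measure_itv/= lte_fin; case: ltP => [_|c0']; first by rewrite oppr0 adde0.
by congr (_%:E); apply/eqP; rewrite eq_le c0 c0'.
Qed.

End unit_noise.

Section quantile.
Context {R : realType}.
Local Open Scope ereal_scope.

(** The upper quantile: it is defined from the tails mu ]z, +oo[, in which
    stochastic monotonicity and the increment condition are expressed. *)
Definition quantile (mu : set R -> \bar R) (u : R) : R :=
  inf [set z | mu `]z, +oo[%classic <= u%:E].

(** The tail of mu is nonincreasing and right continuous, so the infimum is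
    attained: this is the Galois connection between tails and quantiles. *)
Lemma lt_quantile (mu : probability R R) (u z : R) : (0 < u < 1)%R ->
  (z < quantile mu u)%R = (u%:E < mu `]z, +oo[%classic).
Proof.
move=> /andP[u0 u1].
have mid : measurable_fun [set: R] (idfun : R -> R) by exact: measurable_id.
pose idR : {mfun R >-> R} := HB.pack (idfun : R -> R)
  (isMeasurableFun.Build _ _ _ _ idfun mid).
pose S := ccdf (idR : {RV mu >-> R}).
have SE x : mu `]x, +oo[%classic = S x by [].
have Snd : forall x y, (x <= y)%R -> S y <= S x.
  by move=> x y; exact: ccdf_nonincreasing.
have lbS : has_lbound [set x | mu `]x, +oo[%classic <= u%:E].
  have [x0 ux0] : exists x, u%:E < S x.
    apply: contrapT => /forallNP Su.
    suff : 1 <= u%:E by rewrite lee_fin leNgt u1.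
    apply: (cvge_to_le (cvg_ccdfNy1 (idR : {RV mu >-> R}))).
    by apply: nearW => x; rewrite leNgt; apply/negP/Su.
  exists x0 => x /= Sx; rewrite leNgt; apply/negP => xx0.
  by have := lt_le_trans ux0 (Snd _ _ (ltW xx0)); rewrite ltNge -SE Sx.
have neS : [set x | mu `]x, +oo[%classic <= u%:E] !=set0.
  apply: contrapT => /forallNP Su.
  suff : u%:E <= 0 by rewrite lee_fin leNgt u0.
  apply: (cvge_to_ge (cvg_ccdfy0 (idR : {RV mu >-> R}))).
  by apply: nearW => x; rewrite leNgt; apply/negP => /ltW; exact: Su.
rewrite !ltNge; congr (~~ _); apply/idP/idP => [qz|Sz]; last exact: ge_inf.
rewrite SE; apply: (cvge_to_le (@ccdf_right_continuous _ _ _ mu idR z)).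
near=> x.
have : (quantile mu u < x)%R by rewrite (le_lt_trans qz).
move=> /(inf_lt neS)[y /= Sy yx].
by rewrite (le_trans _ Sy)// SE Snd// ltW.
Unshelve. all: by end_near. Qed.


Context (p : R.-pker R ~> R).

(** The kernel with its values registered as probability measures. *)
Definition kernel_law (x : R) : set R -> \bar R := p x.

HB.instance Definition _ x := Measure.on (kernel_law x).

Let kernel_law1 x : kernel_law x setT = 1.
Proof. exact: prob_kernel. Qed.

HB.instance Definition _ x :=
  Measure_isProbability.Build _ _ _ (kernel_law x) (kernel_law1 x).

(** The value 0 outside ]0, 1[ is compatible with both monotonicity
    properties. *)
Definition quantile_fun (w : R * measurableTypeR R) : R :=
  if (0 < w.2 < 1)%R then quantile (p w.1) w.2 else 0%R.

Lemma lt_quantile_fun z x u : (0 < u < 1)%R ->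
  (z < quantile_fun (x, u))%R = (u < fine (p x `]z, +oo[%classic))%R.
Proof.
move=> u01; rewrite /quantile_fun/= u01.
rewrite (lt_quantile (kernel_law x))// -lte_fin fineK//.
exact: (fin_num_measure (kernel_law x)).
Qed.

Lemma measurable_quantile_fun : measurable_fun setT quantile_fun.
Proof.
apply: (measurability (@RGenOInfty.G R)); first exact: RGenOInfty.measurableE.
move=> _ [_ [z ->] <-]; rewrite setTI.
pose b (w : R * measurableTypeR R) : bool := if (0 < w.2 < 1)%R
  then (w.2 < fine (p w.1 `]z, +oo[%classic))%R else (z < 0)%R.
have -> : quantile_fun @^-1` `]z, +oo[%classic = b @^-1` [set true].
  apply/seteqP; split => -[x u]; rewrite /b/= in_itv/= andbT.
    case: ifPn => u01; first by rewrite lt_quantile_fun.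
    by rewrite /quantile_fun/= (negbTE u01).
  case: ifPn => u01; first by rewrite lt_quantile_fun.
  by rewrite /quantile_fun/= (negbTE u01).
have msnd : measurable_fun [set: R * measurableTypeR R] (snd : _ -> R).
  exact: measurable_snd.
rewrite -[X in measurable X]setTI.
suff : measurable_fun setT b by exact.
apply: measurable_fun_if => //.
- by apply: measurable_and; exact: measurable_fun_ltr.
- apply: measurable_funTS; apply: measurable_fun_ltr => //.
  apply: measurableT_comp => //.
  by apply: (measurableT_comp (measurable_kernel p _ _)).
Qed.

Definition quantile_map : random_map R :=
  @RandomMap R _ _ unit_noise _ measurable_quantile_fun.

(** By the Galois connection, the quantile of p x exceeds z exactly for the noises
    u in ]0, 1[ that lie below p x ]z, +oo[, an event of that probability; and the
    open upper rays determine a probability measure. *)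
Lemma quantile_map_law x A : measurable A ->
  noise_law quantile_map [set u | A (quantile_map (x, u))] = p x A.
Proof.
move=> mA.
have mq : measurable_fun setT (fun u => quantile_map (x, u)).
  apply: measurableT_comp; first exact: measurable_move.
  exact: measurable_fun_pair.
pose ray (k : nat) : set R := `](- k%:R)%R, +oo[%classic.
pose mu : {measure set R -> \bar R} :=
  pushforward (noise_law quantile_map) (fun u => quantile_map (x, u)).
change (mu mq A = p x A).
apply: (@measure_unique _ R _ (@RGenOInfty.G R) ray _ _ _ _ (mu mq) (p x)) => //.
- exact: RGenOInfty.measurableE.
- move=> _ _ [a ->] [b ->]; exists (Num.max a b).
  by apply/seteqP; split => z /=; rewrite !in_itv/= !andbT gt_max => /andP.
- by move=> k; exists (- k%:R)%R.
- apply/seteqP; split => // z _; exists (Num.bound z) => //=.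
  by rewrite /ray/= in_itv/= andbT ltrNl unstable.ltrNbound.
- move=> _ [z ->]; rewrite /mu/= /pushforward.
  have pfin := fin_num_measure (kernel_law x) `]z, +oo[%classic
    (measurable_itv _).
  rewrite -[RHS](fineK pfin); apply: unit_noiseE.
    rewrite fine_ge0//= -lee_fin fineK//.
    exact: (probability_le1 (kernel_law x)).
  by move=> u u01; rewrite /= in_itv/= andbT lt_quantile_fun.
- move=> k; rewrite (le_lt_trans _ (ltry 1))//.
  apply: (probability_le1 (noise_law quantile_map)).
  by rewrite -[X in measurable X]setTI; apply: mq => //; exact: measurable_itv.
Qed.

Lemma quantile_map_order_preserving :
  stoch_monotone p -> order_preserving quantile_map.
Proof.
move=> pm u x y xy; rewrite /= leNgt; apply/negP => yx.
have [u01|u01] := boolP (0 < u < 1)%R; last first.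
  by move: yx; rewrite /quantile_fun/= (negbTE u01) ltxx.
have : (quantile_fun (y, u) < quantile_fun (y, u))%R; last by rewrite ltxx.
move: yx; rewrite !lt_quantile_fun// => /lt_le_trans; apply.
by apply: fine_le; [exact: (fin_num_measure (kernel_law x))|
  exact: (fin_num_measure (kernel_law y))|exact: pm].
Qed.

(** The increment condition compares the tail of p(y, .) beyond y + (q - x) with
    the tail of p(x, .) beyond q, where q is the quantile of p(x, .). *)
Lemma quantile_map_increment_reversing :
  increment_condition p -> increment_reversing quantile_map.
Proof.
move=> pi u x y xy /=.
have [u01|u01] := boolP (0 < u < 1)%R; last first.
  by rewrite /quantile_fun/= (negbTE u01) !subr0.
set q := quantile_fun (x, u); set r := quantile_fun (y, u).
suff : (~~ (y + (q - x) < r))%R by rewrite -leNgt; lra.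
rewrite /r lt_quantile_fun//; apply/negP => uy.
have : (q < q)%R; last by rewrite ltxx.
rewrite {2}/q lt_quantile_fun//; apply: lt_le_trans uy _.
apply: fine_le; [exact: (fin_num_measure (kernel_law y))|
  exact: (fin_num_measure (kernel_law x))|].
by rewrite (le_trans (pi (q - x)%R x y xy))// addrC subrK.
Qed.

End quantile.

(** * Variables that depend on the past *)

Section adapted.
Context d (T : measurableType d) (R : realType) (I : Type) (X : I -> T -> R).

Definition adapted dU (U : measurableType dU) (K : set I) (V : T -> U) :=
  forall B, measurable B -> history X K (V @^-1` B).

Lemma adaptedP dU (U : measurableType dU) (K : set I) (V : T -> U) :
  adapted K V <-> measurable_fun setT
    (V : g_sigma_algebraType (\bigcup_(u in K) g_sigma_algebra_preimage (X u))
       -> U).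
Proof.
split=> [aV _ B mB|mV B mB]; first by rewrite setTI; exact: aV.
by rewrite -[V @^-1` B]setTI; exact: mV.
Qed.

Lemma adapted_pair dU dW (U : measurableType dU) (W : measurableType dW)
    (K : set I) (V : T -> U) (V' : T -> W) :
  adapted K V -> adapted K V' -> adapted K (fun w => (V w, V' w)).
Proof.
by move=> /adaptedP aV /adaptedP aV'; apply/adaptedP; exact: measurable_fun_pair.
Qed.

Lemma adapted_sub dU (U : measurableType dU) (K K' : set I) (V : T -> U) :
  K `<=` K' -> adapted K V -> adapted K' V.
Proof.
move=> KK' aV B mB; have := aV B mB; apply: sub_sigma_algebra2.
by move=> A [u Ku XA]; exists u => //; exact: KK'.
Qed.

Lemma adapted_self (K : set I) u : K u -> adapted K (X u).
Proof.
move=> Ku B mB; apply: sub_sigma_algebra; exists u => //.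
by exists B => //; rewrite setTI.
Qed.

End adapted.

(** * Descent along a stationary process and association *)

Section shift.
Context d (T : measurableType d) (R : realType) (P : probability T R)
  (X0 X1 Z0 Z1 : T -> R) (g : random_map R).
Hypotheses (mX0 : measurable_fun setT X0) (mX1 : measurable_fun setT X1)
  (mZ0 : measurable_fun setT Z0) (mZ1 : measurable_fun setT Z1).
Hypotheses (X01 : same_law P P X0 X1).
Hypotheses (XZ0 : driven P X0 X0 Z0 g) (XZ1 : driven P X1 X1 Z1 g).
Local Open Scope ereal_scope.

Lemma driven_same_law :
  same_law P P (fun w => (X0 w, Z0 w)) (fun w => (X1 w, Z1 w)).
Proof.
have mp (X : T -> R) : measurable_fun setT X ->
    measurable_fun setT (fun w : T * noise g => X w.1).
  by move=> mX; exact: measurableT_comp.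
have Xxi : same_law (P \x noise_law g) (P \x noise_law g)
    (fun w => (X0 w.1, w.2)) (fun w => (X1 w.1, w.2)).
  apply: same_law_pair => //; [exact: mp|exact: mp|move=> A B mA mB].
  have E (X : T -> R) : measurable_fun setT X ->
      (P \x noise_law g) ((fun w => X w.1) @^-1` A `&` snd @^-1` B) =
      P (X @^-1` A) * noise_law g B.
    move=> mX; rewrite -[RHS]product_measure1E//.
    by rewrite -[X in measurable X]setTI; exact: mX.
  apply: etrans (E _ mX0) (etrans _ (esym (E _ mX1))); by rewrite X01.
have mg : measurable_fun setT (fun z : R * noise g => (z.1, g (z.1, z.2))).
  apply: measurable_fun_pair => //; apply: measurableT_comp => //.
    exact: measurable_move.
  exact: measurable_fun_pair.
by move=> A mA; rewrite XZ0// XZ1//; exact: (same_law_comp mg Xxi).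
Qed.

Hypotheses (go : order_preserving g) (XZ01 : driven P X0 X1 Z1 g).

(** Shift the pair (X0, Z0) to (X1, Z1), then compare X0 with X1 for the fixed
    variable Z1. *)
Lemma supermodular_descent h :
  measurable_fun setT h -> supermodular h ->
  P.-integrable setT (fun w => (h (X0 w, Z0 w))%:E) ->
  P.-integrable setT (fun w => (h (X0 w, Z1 w))%:E) ->
  \int[P]_w (h (X0 w, Z1 w))%:E <= \int[P]_w (h (X0 w, Z0 w))%:E.
Proof.
move=> mh sh i0 i1; have mEh := (measurable_EFinP _ _).2 mh.
have m0 := measurable_fun_pair mX0 mZ0; have m1 := measurable_fun_pair mX1 mZ1.
rewrite (same_law_integral m0 m1 driven_same_law (f := EFin \o h))//.
apply: (supermodular_driven_le mX0 mX1 mZ1 X01 go XZ01 XZ1) => //.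
exact: (same_law_integrable m0 m1 driven_same_law (f := EFin \o h)).
Qed.

End shift.

Lemma integrable_prod_fun d (T : measurableType d) (R : realType)
    (P : probability T R) (F G : T -> R) :
  P.-integrable setT (EFin \o F) -> P.-integrable setT (EFin \o G) ->
  (P \x P)%E.-integrable setT (fun w => (F w.1 * G w.2)%:E).
Proof.
move=> iF iG.
have mF : measurable_fun setT F by exact/measurable_EFinP/(measurable_int _ iF).
have mG : measurable_fun setT G by exact/measurable_EFinP/(measurable_int _ iG).
apply/integrable12ltyP.
  by apply/measurable_EFinP; apply: measurable_funM; exact: measurableT_comp.
have iF' := integrable_abse iF; have iG' := integrable_abse iG.
under eq_integral => x _.
  under eq_integral do rewrite /= normrM EFinM.
  rewrite ge0_integralZl//; last exact: (measurable_int _ iG').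
  over.
rewrite ge0_integralZr//=; last 2 first.
- exact: (measurable_int _ iF').
- exact: integral_ge0.
by apply: lte_mul_pinfty; [exact: integral_ge0|exact: integrable_fin_num|
  have /integrableP[] := iG].
Qed.

Lemma integral_prod_fun d (T : measurableType d) (R : realType)
    (P : probability T R) (F G : T -> R) :
  P.-integrable setT (EFin \o F) -> P.-integrable setT (EFin \o G) ->
  (\int[P \x P]_w (F w.1 * G w.2)%:E =
   (\int[P]_w (F w)%:E) * (\int[P]_w (G w)%:E))%E.
Proof.
move=> iF iG; rewrite -integral12_prod_meas1; last exact: integrable_prod_fun.
rewrite /fubini_F/=; under eq_integral => x _.
  under eq_integral do rewrite EFinM.
  rewrite integralZl//.
  over.
rewrite -[X in (_ * X)%E]fineK; last exact: integrable_fin_num.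
by rewrite -integralZr// fineK//; exact: integrable_fin_num.
Qed.

Section association.
Context d (T : measurableType d) (R : realType) (P : probability T R)
  (X Z : T -> R) (g : random_map R).
Hypotheses (mX : measurable_fun setT X) (mZ : measurable_fun setT Z).
Hypotheses (go : order_preserving g) (XZ : driven P X X Z g).
Local Open Scope ereal_scope.

Let q A x := noise_law g [set xi | A (g (x, xi))].

Let q0 A x : 0 <= q A x. Proof. exact: measure_ge0. Qed.

Let mq A : measurable A -> measurable_fun setT (q A).
Proof.
move=> mA.
have mgA : measurable [set z : R * noise g | A (g z)].
  by rewrite -[X in measurable X]setTI; exact: measurable_move.
apply: (eq_measurable_fun (fun x => noise_law g
  (xsection [set z : R * noise g | A (g z)] x))); last first.
  exact: measurable_fun_xsection.
move=> x _; congr (noise_law g _).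
by apply/seteqP; split => xi; rewrite /xsection/= inE.
Qed.

Let drivenE B A : measurable B -> measurable A ->
  P (X @^-1` B `&` Z @^-1` A) = \int[P]_w ((\1_B (X w))%:E * q A (X w)).
Proof.
move=> mB mA.
rewrite [LHS](XZ (A := B `*` A)); last exact: measurableX.
apply: eq_integral => w _; rewrite indicE.
case: (boolP (X w \in B)) => [/set_mem|/negP] Bw; rewrite /= ?mul1e ?mul0e.
  congr (noise_law g _).
  by apply/seteqP; split => xi; rewrite /xsection/= inE/= => // -[].
rewrite -[RHS](measure0 (noise_law g)); congr (noise_law g _).
by apply/seteqP; split => xi //=; rewrite /xsection/= inE => -[/= /mem_set].
Qed.

Let restrictE (V Y : T * T -> R) B A :
  \int[P \x P]_(w in V @^-1` B) q A (Y w) =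
  \int[P \x P]_w ((\1_B (V w))%:E * q A (Y w)).
Proof.
rewrite [LHS]integral_mkcond/=.
apply: eq_integral => w _; rewrite patchE/= indicE.
have -> : (w \in V @^-1` B) = (V w \in B) by [].
by case: (V w \in B); rewrite ?mul1e ?mul0e.
Qed.

(** The first coordinate is independent of the second one and may serve as the
    past. *)
Lemma driven_independent :
  driven (P \x P)%E (fun w : T * T => X w.1) (fun w => X w.2) (fun w => Z w.2) g.
Proof.
apply: drivenI; try exact: measurableT_comp.
move=> B A mB mA.
have mXB : measurable (X @^-1` B) by rewrite -[X in measurable X]setTI; exact: mX.
have mZA : measurable (Z @^-1` A) by rewrite -[X in measurable X]setTI; exact: mZ.
transitivity ((P \x P)%E ((X @^-1` B) `*` (Z @^-1` A))) => //.
rewrite product_measure1E//.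
have PZ : P (Z @^-1` A) = \int[P]_w q A (X w).
  transitivity (P (X @^-1` setT `&` Z @^-1` A)).
    by congr (P _); apply/seteqP; split => w //= [].
  by rewrite drivenE//; apply: eq_integral => w _; rewrite indicE in_setT mul1e.
have PX : P (X @^-1` B) = \int[P]_w (\1_B (X w))%:E.
  transitivity (\int[P]_w (\1_(X @^-1` B) w)%:E).
    by rewrite integral_indic// setIT.
  by apply: eq_integral => w _; by rewrite !indicE.
transitivity ((\int[P]_w (\1_B (X w))%:E) * (\int[P]_w q A (X w))).
  by congr (_ * _).
rewrite [RHS]restrictE.
rewrite fubini_tonelli1//=; last 2 first.
- apply: emeasurable_funM.
    by apply/measurable_EFinP; apply: measurableT_comp => //; exact: measurableT_comp.
  by apply: measurableT_comp (mq mA) _; exact: measurableT_comp.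
- by move=> w; rewrite mule_ge0// lee_fin.
have mqX : measurable_fun setT (q A \o X).
  by apply: measurableT_comp => //; exact: mq.
have mBX : measurable_fun setT (fun w => (\1_B (X w))%:E : \bar R).
  by apply/measurable_EFinP; exact: measurableT_comp.
rewrite -ge0_integralZr//.
- by apply: eq_integral => w _; rewrite /fubini_F/= ge0_integralZl// lee_fin.
- exact: integral_ge0.
Qed.

Lemma same_law_snd dU (U : measurableType dU) (V : T -> U) :
  measurable_fun setT V ->
  same_law (P \x P)%E P (fun w : T * T => V w.2) V.
Proof.
move=> mV A mA.
have mVA : measurable (V @^-1` A) by rewrite -[X in measurable X]setTI; exact: mV.
transitivity ((P \x P)%E (setT `*` (V @^-1` A))).
  by congr ((P \x P)%E _); apply/seteqP; split => w //= [].
rewrite product_measure1E// -[RHS]mul1e; congr (_ * _).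
exact: (@probability_setT _ _ _ P).
Qed.

Lemma driven_snd :
  driven (P \x P)%E (fun w : T * T => X w.2) (fun w => X w.2) (fun w => Z w.2) g.
Proof.
have mX2 : measurable_fun setT (fun w : T * T => X w.2) by exact: measurableT_comp.
have mZ2 : measurable_fun setT (fun w : T * T => Z w.2) by exact: measurableT_comp.
apply: drivenI => // B A mB mA.
have mXB : measurable (X @^-1` B) by rewrite -[X in measurable X]setTI; exact: mX.
transitivity (P (X @^-1` B `&` Z @^-1` A)).
  by apply: (same_law_snd (measurable_fun_pair mX mZ) (A := B `*` A));
    exact: measurableX.
rewrite drivenE// [RHS]restrictE.
rewrite (ge0_same_law_integral _ _ (same_law_snd mX)
  (f := fun x => (\1_B x)%:E * q A x))//.
- apply: emeasurable_funM; last exact: mq.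
  by apply/measurable_EFinP.
- by move=> x; rewrite mule_ge0// lee_fin.
Qed.

(** Apply the comparison on the square of the probability space, where X has an
    independent copy: on the left f is evaluated at the copy, so that the
    expectation factors. *)
Lemma driven_association f : {homo f : x y / (x <= y)%R} ->
  P.-integrable setT (fun w => (f (X w))%:E) ->
  P.-integrable setT (fun w => (Z w)%:E) ->
  P.-integrable setT (fun w => (f (X w) * Z w)%:E) ->
  (\int[P]_w (f (X w))%:E) * (\int[P]_w (Z w)%:E) <=
    \int[P]_w (f (X w) * Z w)%:E.
Proof.
move=> fh ifX iZ ifXZ.
have mf : measurable_fun setT f by exact: nondecreasing_measurable.
pose h (z : R * R) := (f z.1 * z.2)%R.
have mh : measurable_fun setT h.
  by apply: measurable_funM => //; exact: measurableT_comp.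
have sh : supermodular h.
  move=> x1 x2 y1 y2 /fh f12 y12; rewrite /h/= -subr_ge0.
  by rewrite (_ : _ - _ = (f x2 - f x1) * (y2 - y1))%R; [nra|ring].

have i1 : P.-integrable setT (EFin \o cst 1%R).
  exact: finite_measure_integrable_cst.
have swapE F : P.-integrable setT (EFin \o F) ->
    (P \x P).-integrable setT (fun w => (F w.2)%:E) /\
    \int[P \x P]_w (F w.2)%:E = \int[P]_w (F w)%:E.
  move=> iF; have := integrable_prod_fun i1 iF; have := integral_prod_fun i1 iF.
  have -> : \int[P]_w (cst 1%R w)%:E = 1.
    transitivity (\int[P]_w (cst 1 w)) => //.
    rewrite integral_cst// mul1e; exact: (@probability_setT _ _ _ P).
  rewrite !mul1e.
  by under eq_fun do rewrite mul1r.
have [i2 <-] := swapE _ ifXZ.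
rewrite -integral_prod_fun//.
apply: (@supermodular_driven_le _ _ _ (P \x P)%E (fun w => X w.1)
  (fun w => X w.2) (fun w => Z w.2) g _ _ _ _ go _ _ h mh sh);
  try exact: measurableT_comp.
- move=> A mA.
  have mXA : measurable (X @^-1` A).
    by rewrite -[X in measurable X]setTI; exact: mX.
  transitivity ((P \x P)%E ((X @^-1` A) `*` setT)).
    by congr ((P \x P)%E _); apply/seteqP; split => w //= [].
  transitivity ((P \x P)%E (setT `*` (X @^-1` A))); last first.
    by congr ((P \x P)%E _); apply/seteqP; split => w //= [].
  by rewrite !product_measure1E// muleC.
- exact: driven_independent.
- exact: driven_snd.
- exact: (integrable_prod_fun ifX iZ).
- exact: i2.
Qed.
End association.

(** * Stationary processes driven by monotone random maps *)

(** The common setting of discrete and continuous time: D is the set of times,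
    [past t] the set of times up to t, and [g t] realises the transition over a
    time t. *)
Section stationary_flow.
Context d (T : measurableType d) (R : realType) (P : probability T R)
  (I : nmodType) (D : set I) (X : I -> {RV P >-> R}) (past : I -> set I)
  (g : I -> random_map R).
Hypotheses (D0 : D 0) (DD : forall s t, D s -> D t -> D (s + t)).
Hypotheses (past0 : forall t, D t -> past t 0)
  (past_self : forall t, D t -> past t t)
  (past_mono : forall s t, D s -> D t -> past s `<=` past (s + t)).
Hypothesis X_law : forall t, D t -> same_law P P (X 0) (X t).
Hypotheses (g_order : forall t, D t -> order_preserving (g t))
  (g_incr : forall t, D t -> increment_reversing (g t)).
Hypothesis X_driven : forall s t, D s -> D t ->
  forall dU (U : measurableType dU) (V : T -> U), measurable_fun setT V ->
    adapted X (past s) V -> driven P V (X s) (X (s + t)) (g t).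

Let mX t : measurable_fun setT (X t). Proof. exact: measurable_funPT. Qed.

Lemma state_driven u s t : D u -> D s -> past s u ->
  D t -> driven P (X u) (X s) (X (s + t)) (g t).
Proof.
by move=> Du Ds su Dt; apply: X_driven => //; exact: adapted_self.
Qed.

Lemma drop_driven u s t r : D u -> D s -> past s u -> D t -> D r ->
  driven P (X u) (X s) (fun w => X (s + t) w - X (s + t + r) w)
    (drop_map (g t) (g r)).
Proof.
move=> Du Ds su Dt Dr; apply: driven_drop_map => //.
  exact: state_driven.
apply: X_driven => //; [exact: DD|exact: measurable_fun_pair|].
apply: adapted_pair; last by apply: adapted_self; apply: past_self; exact: DD.
apply: adapted_self; exact: (past_mono Ds Dt su).
Qed.

Lemma expectation_hincr_le (h : R * R -> R) r t s : D r -> D t -> D s ->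
  measurable_fun setT h -> supermodular h ->
  P.-integrable setT (EFin \o hincr X h r t) ->
  P.-integrable setT (EFin \o hincr X h r (s + t)) ->
  ('E_P[hincr X h r (s + t)] <= 'E_P[hincr X h r t])%E.
Proof.
move=> Dr Dt Ds mh sh i1 i2; rewrite unlock.
have d0 := drop_driven D0 D0 (past0 D0) Dt Dr; rewrite add0r in d0.
apply: (supermodular_descent _ _ _ _ (X_law Ds) d0
  (drop_driven Ds Ds (past_self Ds) Dt Dr)
  (drop_map_order_preserving (g_order Dt) (g_incr Dr))
  (drop_driven D0 Ds (past0 Ds) Dt Dr) mh sh i1 i2) => //.
- exact: measurable_funB.
- exact: measurable_funB.
Qed.

Section covariance.
Variable f : R -> R.
Hypothesis f_nd : {homo f : x y / x <= y}.
Hypotheses (ifX : P.-integrable setT (EFin \o (fun w => f (X 0 w))))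
  (iX : P.-integrable setT (EFin \o X 0))
  (ifXX : forall t, D t ->
    P.-integrable setT (EFin \o (fun w => f (X 0 w) * X t w))).

Let h (z : R * R) := f z.1 * z.2.

Let mf : measurable_fun setT f. Proof. exact: nondecreasing_measurable. Qed.

Let mh : measurable_fun setT h.
Proof. by apply: measurable_funM => //; exact: measurableT_comp. Qed.

Let sh : supermodular h.
Proof.
move=> x1 x2 y1 y2 /f_nd f12 y12; rewrite /h/= -subr_ge0.
by rewrite (_ : _ - _ = (f x2 - f x1) * (y2 - y1)); [nra|ring].
Qed.

Let mom t : R := fine (\int[P]_w (f (X 0 w) * X t w)%:E).

Let momE t : D t -> (\int[P]_w (f (X 0 w) * X t w)%:E)%E = (mom t)%:E.
Proof. by move=> Dt; rewrite fineK//; apply: integrable_fin_num => //; exact: ifXX. Qed.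

Let iXt t : D t -> P.-integrable setT (EFin \o X t).
Proof. by move=> Dt; exact: (same_law_integrable (mX 0) (mX t) (X_law Dt) (f := EFin)). Qed.

Let intX t : D t -> (\int[P]_w (X t w)%:E = \int[P]_w (X 0 w)%:E)%E.
Proof. by move=> Dt; rewrite -(same_law_integral (mX 0) (mX t) (X_law Dt) (f := EFin)). Qed.

(* by stationarity the product of the means does not depend on time *)
Let c := fine (\int[P]_w (f (X 0 w))%:E * \int[P]_w (X 0 w)%:E)%E.

Lemma covariance_split t : D t -> covariance P (f \o X 0) (X t) = (mom t - c)%:E.
Proof.
move=> Dt; rewrite covarianceE; last 3 first.
- exact/Lfun1_integrable.
- exact/Lfun1_integrable/iXt.
- exact/Lfun1_integrable/ifXX.
rewrite unlock EFinB -momE// intX// /c fineK//.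
by rewrite fin_numM//; exact: integrable_fin_num.
Qed.

Lemma covfE t : D t -> covf X f t = mom t - c.
Proof. by move=> Dt; rewrite /covf covariance_split. Qed.

Lemma covf_ge0 t : D t -> 0 <= covf X f t.
Proof.
move=> Dt; rewrite covfE// subr_ge0 -lee_fin -momE// /c fineK; last first.
  by rewrite fin_numM//; exact: integrable_fin_num.
rewrite -(intX Dt).
have dt := state_driven D0 D0 (past0 D0) Dt; rewrite add0r in dt.
apply: (driven_association _ _ (g_order Dt) dt) => //; [exact: iXt|exact: ifXX].
Qed.

Lemma covf_le t s : D t -> D s -> covf X f (s + t) <= covf X f t.
Proof.
move=> Dt Ds; rewrite !covfE//; last exact: DD.
rewrite lerD2r -lee_fin -!momE//; last exact: DD.
have d0 := state_driven D0 D0 (past0 D0) Dt; rewrite add0r in d0.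
apply: (supermodular_descent _ _ _ _ (X_law Ds) d0
  (state_driven Ds Ds (past_self Ds) Dt) (g_order Dt)
  (state_driven D0 Ds (past0 Ds) Dt) mh sh) => //.
- exact: ifXX.
- by apply: ifXX; exact: DD.
Qed.

(** For h(x, y) = f(x) y, the expectation of h(X_0, X_u - X_(u+r)) is the drop of
    the covariance between u and u + r. *)
Lemma covf_drop_le r t s : D r -> D t -> D s ->
  covf X f (s + t) - covf X f (s + t + r) <= covf X f t - covf X f (t + r).
Proof.
move=> Dr Dt Ds; rewrite !covfE//; try by do ?apply: DD.
have ih u : D u -> P.-integrable setT (EFin \o hincr X h r u) /\
    ('E_P[hincr X h r u] = (mom u - mom (u + r))%:E)%E.
  move=> Du; have Dur := DD Du Dr.
  have -> : EFin \o hincr X h r u = ((EFin \o (fun w => f (X 0 w) * X u w)%R) \-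
      (EFin \o (fun w => f (X 0 w) * X (u + r) w)%R))%E.
    by apply/funext => w; rewrite /hincr/h/= mulrBr EFinB.
  split; first by apply: integrableB => //; exact: ifXX.
  rewrite unlock EFinB -!momE// -integralB//; [|exact: ifXX|exact: ifXX].
  by apply: eq_integral => w _; rewrite /hincr/h/= mulrBr EFinB.
have [i1 e1] := ih _ Dt; have [i2 e2] := ih _ (DD Ds Dt).
have := expectation_hincr_le Dr Dt Ds mh sh i1 i2.
by rewrite e1 e2 lee_fin; lra.
Qed.

End covariance.
End stationary_flow.

(** * From decreasing drops to convexity *)

Section convexity.
Context {R : realType}.

(** Induction on n: the increments before k <= n are at most the n-th one, so
    u k - u 0 <= k (u n.+1 - u n). *)
Lemma convex_seq_chord (u : nat -> R) (k n : nat) : convex_seq u -> (k <= n)%N ->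
  n%:R * (u k - u 0) <= k%:R * (u n - u 0).
Proof.
move=> uc; elim: n k => [|n ih] k; first by rewrite leqn0 => /eqP ->.
rewrite leq_eqVlt => /predU1P[->//|]; rewrite ltnS => kn.
have uk j : (j <= n)%N -> u j - u 0 <= j%:R * (u n.+1 - u n).
  elim: j => [_|j ihj jn]; first by rewrite subrr mul0r.
  have := ihj (ltnW jn); have := uc _ _ (ltnW jn); rewrite -[j.+1%:R]natr1; lra.
have := ih _ kn; have := uk _ kn; rewrite -[n.+1%:R]natr1; lra.
Qed.

(** On the grid of n steps from a to b the chord inequality is that of convex
    sequences.  A point c between two grid points has C c at most the value at
    the grid point on its left, which costs (C a - C b) / n; n is arbitrary. *)
Lemma nonincreasing_chord_le (C : R -> R) (a b theta : R) :
  (forall t s, a <= t -> 0 <= s -> C (s + t) <= C t) ->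
  (forall r t s, 0 <= r -> a <= t -> 0 <= s ->
    C (s + t) - C (s + t + r) <= C t - C (t + r)) ->
  a <= b -> 0 <= theta <= 1 ->
  C (a + theta * (b - a)) <= C a + theta * (C b - C a).
Proof.
move=> Cd Cc ab /andP[th0 th1].
have Cba : C b <= C a.
  by have := @Cd a (b - a) (lexx _); rewrite subrK; apply; rewrite subr_ge0.
set c := a + _; set L := C a + _.
suff nC n : (0 < n)%N -> n%:R * (C c - L) <= C a - C b.
  rewrite leNgt; apply/negP => Lc.
  have e0 : 0 < C c - L by rewrite subr_gt0.
  have := nC (Num.bound ((C a - C b) / (C c - L))).+1 isT.
  rewrite leNgt => /negP; apply; rewrite -ltr_pdivrMr//.
  by rewrite (lt_le_trans (unstable.ltr_bound _))// ler_nat.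
move=> n0; have nR : 0 < n%:R :> R by rewrite ltr0n.
pose e := (b - a) / n%:R.
have e0 : 0 <= e by rewrite divr_ge0 ?subr_ge0.
pose u k := C (a + k%:R * e).
have ae k : a <= a + k%:R * e by rewrite lerDl mulr_ge0.
have uc : convex_seq u.
  move=> i j ij.
  have := @Cc e (a + i%:R * e) ((j - i)%:R * e) e0 (ae i) (mulr_ge0 (ler0n _ _) e0).
  have -> : (j - i)%:R * e + (a + i%:R * e) = a + j%:R * e.
    by rewrite natrB//; ring.
  rewrite /u -!natr1 !mulrDl !mul1r !addrA; lra.
pose k := Num.truncn (theta * n%:R).
have tn0 : 0 <= theta * n%:R by rewrite mulr_ge0.
have /andP[kle klt] := truncn_itv tn0.
have kn : (k <= n)%N.
  by rewrite -(ler_nat R) (le_trans kle)// ler_piMl.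
have := convex_seq_chord uc kn.
have -> : u 0 = C a by rewrite /u mul0r addr0.
have -> : u n = C b by rewrite /u /e mulrC divfK ?gt_eqF// addrC subrK.
have : C c <= u k.
  have cE : c = (theta * n%:R - k%:R) * e + (a + k%:R * e).
    by rewrite /c /e; field; rewrite gt_eqF.
  by rewrite cE; apply: Cd => //; rewrite mulr_ge0// subr_ge0.
move: kle klt; rewrite -natr1 /L -/k; move: (u k) (k%:R : R) => uk kR.
nra.
Qed.

Lemma nonincreasing_wright_convex (C : R -> R) :
  (forall t s, 0 <= t -> 0 <= s -> C (s + t) <= C t) ->
  (forall r t s, 0 <= r -> 0 <= t -> 0 <= s ->
    C (s + t) - C (s + t + r) <= C t - C (t + r)) ->
  convex_function ([set t | 0 <= t] : set R^o) C.
Proof.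
move=> Cd Cc.
have chord a b theta : 0 <= a -> a <= b -> 0 <= theta <= 1 ->
    C (a + theta * (b - a)) <= C a + theta * (C b - C a).
  move=> a0; apply: nonincreasing_chord_le.
  - by move=> t s ta; apply: Cd; exact: le_trans ta.
  - by move=> r t s r0 ta; apply: Cc => //; exact: le_trans ta.
move=> t x y /set_mem /= x0 /set_mem /= y0.
rewrite [leRHS]convRE.
change (C (t%:num * x + (1 - t%:num) * y) <= t%:num * C x + (1 - t%:num) * C y).
have /andP[t0 t1] : 0 <= t%:num <= 1 by apply/andP.
move: (t%:num : R) t0 t1 => th th0 th1.
have [xy|/ltW yx] := leP x y.
- have := @chord x y (1 - th) x0 xy.
  rewrite (_ : x + _ = th * x + (1 - th) * y); last by ring.
  by rewrite (_ : C x + _ = th * C x + (1 - th) * C y); [apply; lra|ring].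
- have := @chord y x th y0 yx.
  rewrite (_ : y + _ = th * x + (1 - th) * y); last by ring.
  by rewrite (_ : C y + _ = th * C x + (1 - th) * C y); [apply; lra|ring].
Qed.

End convexity.

(** * Discrete and continuous time *)

Section identity.
Context {R : realType}.

Lemma measurable_stay : measurable_fun [set: R * measurableTypeR R] (fst : _ -> R).
Proof. exact: measurable_fst. Qed.

Definition stay : random_map R := @RandomMap R _ _ unit_noise _ measurable_stay.

Lemma driven_stay d (T : measurableType d) (P : probability T R)
    dU (U : measurableType dU) (V : T -> U) (Y : T -> R) :
  measurable_fun setT V -> measurable_fun setT Y -> driven P V Y Y stay.
Proof.
move=> mV mY; apply: drivenI => // B A mB mA.
have mVB : measurable (V @^-1` B) by rewrite -[X in measurable X]setTI; exact: mV.
have mYA : measurable (Y @^-1` A) by rewrite -[X in measurable X]setTI; exact: mY.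
rewrite setIC -integral_indic//.
apply: eq_integral => w _; rewrite indicE.
have [Aw|Aw] := boolP (w \in Y @^-1` A).
  rewrite -[LHS](@probability_setT _ _ _ (noise_law stay)).
  congr (noise_law stay _); apply/seteqP; split => // xi _ /=.
  exact: (set_mem Aw).
rewrite -[LHS](measure0 (noise_law stay)); congr (noise_law stay _).
by apply/seteqP; split => xi //= AY; move: Aw; rewrite mem_set.
Qed.

Lemma stay_increment_reversing : increment_reversing stay.
Proof. by move=> xi x y xy /=; rewrite !subrr. Qed.

Fixpoint iter_map (g : random_map R) (n : nat) : random_map R :=
  if n is m.+1 then comp_map (iter_map g m) g else stay.

Lemma iter_map_order_preserving g n :
  order_preserving g -> order_preserving (iter_map g n).
Proof.
by move=> go; elim: n => //= n ih; exact: comp_map_order_preserving.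
Qed.

Lemma iter_map_increment_reversing g n : order_preserving g ->
  increment_reversing g -> increment_reversing (iter_map g n).
Proof.
move=> go gi; elim: n => [|n ih]; first exact: stay_increment_reversing.
by apply: comp_map_increment_reversing => //; exact: iter_map_order_preserving.
Qed.

End identity.

Lemma stationary_same_law d (T : measurableType d) (R : realType)
    (P : probability T R) (I : nmodType) (D : set I) (X : I -> {RV P >-> R}) t :
  stationary D X -> D 0 -> D t -> same_law P P (X 0) (X t).
Proof.
move=> sX D0 Dt A mA.
have := sX 1%N (fun=> 0) t (fun=> A) (fun=> D0) Dt (fun=> mA).
rewrite add0r => e; symmetry; move: e.
congr (P _ = P _); apply/seteqP; split => w /=; do ?[by move=> /(_ ord0)].
all: by move=> ? ?.
Qed.

Lemma kernel_driven d (T : measurableType d) (R : realType)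
    (P : probability T R) dU (U : measurableType dU) (V : T -> U)
    (Y Z : T -> R) (p : R.-pker R ~> R) :
  measurable_fun setT V -> measurable_fun setT Y -> measurable_fun setT Z ->
  (forall B A, measurable B -> measurable A ->
    P (V @^-1` B `&` Z @^-1` A) = \int[P]_(w in V @^-1` B) p (Y w) A)%E ->
  driven P V Y Z (quantile_map p).
Proof.
move=> mV mY mZ VZ; apply: drivenI => // B A mB mA; rewrite VZ//.
by apply: eq_integral => w _; rewrite quantile_map_law.
Qed.

Section discrete.
Context d (T : measurableType d) (R : realType) (P : probability T R)
  (X : nat -> {RV P >-> R}) (p : R.-pker R ~> R).
Hypothesis Xp : discrete_markov X p.

(** At each step the pair formed by V and the current state is a new past. *)
Lemma discrete_driven (s t : nat) dU (U : measurableType dU) (V : T -> U) :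
  measurable_fun setT V -> adapted X [set u | (u <= s)%N] V ->
  driven P V (X s) (X (s + t)%N) (iter_map (quantile_map p) t).
Proof.
move=> mV aV; elim: t => [|t ih]; first by rewrite addn0; apply: driven_stay.
apply: (driven_comp_map _ _ (W := X (s + t)%N)) => //.
have aVX : adapted X [set u | (u <= s + t)%N] (fun w => (V w, X (s + t)%N w)).
  apply: adapted_pair; last by apply: adapted_self => /=.
  apply: (adapted_sub _ aV) => u /= us; exact: leq_trans us (leq_addr _ _).
apply: kernel_driven => //; first exact: measurable_fun_pair.
by move=> B A mB mA; rewrite addnS; apply: Xp => //; exact: aVX.
Qed.

End discrete.

Section continuous.
Context d (T : measurableType d) (R : realType) (P : probability T R)
  (X : R -> {RV P >-> R}) (p : R -> R.-pker R ~> R).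
Hypothesis Xp : continuous_markov X p.

Lemma continuous_driven (s t : R) : 0 <= s -> 0 <= t ->
  forall dU (U : measurableType dU) (V : T -> U),
  measurable_fun setT V -> adapted X `[0, s]%classic V ->
  driven P V (X s) (X (s + t)) (quantile_map (p t)).
Proof.
move=> s0 t0 dU U V mV aV; apply: kernel_driven => // B A mB mA.
by apply: (Xp.2) => //; exact: aV.
Qed.

(** Time 0 is excluded from the hypotheses on the kernels, but p 0 is the
    identity kernel. *)
Lemma kernel0_stoch_monotone : stoch_monotone (p 0).
Proof.
move=> y x1 x2 x12; have [[p0 _] _] := Xp; rewrite !p0// !diracE lee_fin ler_nat.
rewrite !mem_setE !in_itv/= !andbT; case: ltP => // yx1.
by rewrite (lt_le_trans yx1 x12).
Qed.

Lemma kernel0_increment_condition : increment_condition (p 0).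
Proof.
move=> y x1 x2 x12; have [[p0 _] _] := Xp; rewrite !p0// !diracE.
by rewrite !mem_setE !in_itv/= !andbT !gtrDl.
Qed.

End continuous.

Theorem theorem4 (R : realType) (d : measure_display)
    (Omega : measurableType d) (P : probability Omega R) :
  (* discrete time *)
  (forall (X : nat -> {RV P >-> R}) (p : R.-pker R ~> R),
    discrete_markov X p ->
    stationary [set: nat] X ->
    stoch_monotone p ->
    increment_condition p ->
    (forall (s : nat) (h : R * R -> R), (0 < s)%N ->
      measurable_fun [set: R * R] h -> supermodular h ->
      (forall t : nat,
        P.-integrable setT (EFin \o hincr X h s t)) ->
      forall t1 t2 : nat, (t1 <= t2)%N ->
        ('E_P[hincr X h s t2] <= 'E_P[hincr X h s t1])%E) /\
    (forall f : R -> R, {homo f : x y / x <= y} ->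
      P.-integrable setT (EFin \o (fun w => f (X 0 w))) ->
      P.-integrable setT (EFin \o X 0) ->
      (forall t : nat, P.-integrable setT (EFin \o (fun w => f (X 0 w) * X t w))) ->
      [/\ forall t : nat, covariance P (f \o X 0) (X t) \is a fin_num,
          forall t : nat, 0 <= covf X f t,
          forall t1 t2 : nat, (t1 <= t2)%N -> covf X f t2 <= covf X f t1 &
          convex_seq (covf X f)])) /\
  (* continuous time *)
  (forall (X : R -> {RV P >-> R}) (p : R -> R.-pker R ~> R),
    continuous_markov X p ->
    stationary [set t : R | 0 <= t] X ->
    (forall t : R, 0 < t -> stoch_monotone (p t)) ->
    (forall t : R, 0 < t -> increment_condition (p t)) ->
    (forall (s : R) (h : R * R -> R), 0 < s ->
      measurable_fun [set: R * R] h -> supermodular h ->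
      (forall t : R, 0 <= t ->
        P.-integrable setT (EFin \o hincr X h s t)) ->
      forall t1 t2 : R, 0 <= t1 -> t1 <= t2 ->
        ('E_P[hincr X h s t2] <= 'E_P[hincr X h s t1])%E) /\
    (forall f : R -> R, {homo f : x y / x <= y} ->
      P.-integrable setT (EFin \o (fun w => f (X 0 w))) ->
      P.-integrable setT (EFin \o X 0) ->
      (forall t : R, 0 <= t ->
        P.-integrable setT (EFin \o (fun w => f (X 0 w) * X t w))) ->
      [/\ forall t : R, 0 <= t -> covariance P (f \o X 0) (X t) \is a fin_num,
          forall t : R, 0 <= t -> 0 <= covf X f t,
          forall t1 t2 : R, 0 <= t1 -> t1 <= t2 -> covf X f t2 <= covf X f t1 &
          convex_function ([set t | 0 <= t] : set R^o) (covf X f)])).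
Proof.
split.
- move=> X p Xp sX pm pi.
  have D0 : [set: nat] 0 by [].
  have DD (s t : nat) : [set: nat] s -> [set: nat] t -> [set: nat] (s + t) by [].
  pose past (t : nat) : set nat := [set u | (u <= t)%N].
  have past0 t : [set: nat] t -> past t 0 by [].
  have past_self t : [set: nat] t -> past t t by move=> _; rewrite /past/=.
  have past_mono s t : [set: nat] s -> [set: nat] t -> past s `<=` past (s + t).
    by move=> _ _ u /= us; exact: leq_trans us (leq_addr _ _).
  pose g (t : nat) := iter_map (quantile_map p) t.
  have go t : [set: nat] t -> order_preserving (g t).
    by move=> _; apply: iter_map_order_preserving; exact: quantile_map_order_preserving.
  have gi t : [set: nat] t -> increment_reversing (g t).
    move=> _; apply: iter_map_increment_reversing.
      exact: quantile_map_order_preserving.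
    exact: quantile_map_increment_reversing.
  have law t : [set: nat] t -> same_law P P (X 0) (X t).
    by move=> Dt; exact: stationary_same_law sX D0 Dt.
  have drv (s t : nat) : [set: nat] s -> [set: nat] t ->
      forall dU (U : measurableType dU) (V : Omega -> U),
      measurable_fun setT V -> adapted X (past s) V ->
      driven P V (X s) (X (s + t)) (g t).
    by move=> _ _ dU U V mV aV; exact: (discrete_driven Xp).
  split=> [s h _ mh sh ih t1 t2 t12|f fnd ifX iX ifXX].
    rewrite -(subnK t12).
    exact: (expectation_hincr_le D0 DD past0 past_self past_mono law go gi drv).
  have ifXX' t : [set: nat] t ->
      P.-integrable setT (EFin \o (fun w => f (X 0 w) * X t w)) by [].
  have sub := covf_drop_le D0 DD past0 past_self past_mono law go gi drv fnd
    ifX iX ifXX'.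
  split.
  + move=> t; rewrite (covariance_split law ifX iX ifXX')//.
  + move=> t; exact: (covf_ge0 D0 past0 law go drv fnd ifX iX ifXX').
  + move=> t1 t2 t12; rewrite -(subnK t12).
    exact: (covf_le D0 DD past0 past_self law go drv fnd ifX iX ifXX').
  + move=> m n mn; have := sub 1%N m (n - m)%N I I I.
    rewrite (_ : (n - m)%N + m = n)%R; last exact: subnK.
    rewrite (_ : n + 1%N = n.+1)%R; last exact: addn1.
    rewrite (_ : m + 1%N = m.+1)%R; last exact: addn1.
    lra.
- move=> X p Xp sX pm pi.
  pose D : set R := [set t : R | 0 <= t].
  have D0 : D 0 by rewrite /D/=.
  have DD s t : D s -> D t -> D (s + t) by exact: addr_ge0.
  pose past (t : R) : set R := `[0, t]%classic.
  have past0 t : D t -> past t 0 by move=> Dt; rewrite /past/= in_itv/= lexx.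
  have past_self t : D t -> past t t.
    by move=> Dt; rewrite /past/= in_itv/= lexx andbT.
  have past_mono s t : D s -> D t -> past s `<=` past (s + t).
    move=> Ds Dt u; rewrite /past/= !in_itv/= => /andP[-> us].
    by rewrite (le_trans us)// lerDl.
  pose g t := quantile_map (p t).
  have go t : D t -> order_preserving (g t).
    rewrite /D/= le_eqVlt => /predU1P[<-|t0];
      apply: quantile_map_order_preserving; last exact: pm.
    exact: kernel0_stoch_monotone Xp.
  have gi t : D t -> increment_reversing (g t).
    rewrite /D/= le_eqVlt => /predU1P[<-|t0];
      apply: quantile_map_increment_reversing; last exact: pi.
    exact: kernel0_increment_condition Xp.
  have law t : D t -> same_law P P (X 0) (X t).
    by move=> Dt; exact: stationary_same_law sX D0 Dt.
  have drv := continuous_driven Xp.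
  split=> [s h s0 mh sh ih t1 t2 t10 t12|f fnd ifX iX ifXX].
    have s0' : D s by exact: ltW.
    have t20 := le_trans t10 t12.
    rewrite -(subrK t1 t2).
    apply: (expectation_hincr_le D0 DD past0 past_self past_mono law go gi drv)
      => //; [|exact: ih|rewrite subrK; exact: ih].
    by rewrite /D/= subr_ge0.
  have sub := covf_drop_le D0 DD past0 past_self past_mono law go gi drv fnd
    ifX iX ifXX.
  have dec := covf_le D0 DD past0 past_self law go drv fnd ifX iX ifXX.
  split.
  + by move=> t Dt; rewrite (covariance_split law ifX iX ifXX).
  + move=> t Dt; exact: (covf_ge0 D0 past0 law go drv fnd ifX iX ifXX).
  + move=> t1 t2 t10 t12; rewrite -(subrK t1 t2); apply: dec => //.
    by rewrite /D/= subr_ge0.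
  + apply: nonincreasing_wright_convex; [exact: dec|exact: sub].
Qed.
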